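(* Let $k$ be a field and let $d \geq 3$ be an integer. Let $k\Theta(d)$ be the path algebra of the generalised Kronecker quiver $\Theta(d)$. Then the family of all finite dimensional preprojective $k\Theta(d)$-modules is hyperfinite.
   Context: The generalised Kronecker quiver $\Theta(d)$ has two vertices $1,2$ and exactly $d$ arrows, all going from $1$ to $2$. Modules over $k\Theta(d)$ are identified with representations of $\Theta(d)$ over $k$. A finite dimensional module is preprojective if each of its indecomposable direct summands is of the form $\tau^{-r}P$ with $r \geq 0$ and $P$ indecomposable projective, where $\tau$ is the Auslander–Reiten translation. Hyperfiniteness: Let $A$ be a finite dimensional $k$-algebra and let $\mathcal{M}$ be a set of finite dimensional $A$-modules (a family of modules is understood up to isomorphism). $\mathcal{M}$ is hyperfinite if for every $\varepsilon > 0$ there exists a number $L_\varepsilon > 0$ such that for every $M \in \mathcal{M}$ there exist a submodule $N \subseteq M$ with $\dim_k N \geq (1-\varepsilon)\dim_k M$ and finite dimensional $A$-modules $N_1,\dots,N_t$ with $\dim_k N_i \leq L_\varepsilon$ for all $i$, such that $N \cong \bigoplus_{i=1}^t N_i$. *)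

(* Defs.v *)
From mathcomp Require Import all_boot all_order all_algebra.
From mathcomp Require Import reals.

Set Implicit Arguments.
Unset Strict Implicit.
Unset Printing Implicit Defensive.

Import Order.TTheory GRing.Theory Num.Theory.
Local Open Scope ring_scope.

(* Primitive projections (eta) make opq (opq Q) convertible to Q. *)
Set Primitive Projections.
Record quiver := Quiver {
  vertex : finType;
  arrow : finType;
  src : arrow -> vertex;
  tgt : arrow -> vertex }.
Unset Primitive Projections.

Definition opq (Q : quiver) : quiver := Quiver (@tgt Q) (@src Q).

(* The vertices 1 and 2 are encoded as false and true. *)
Definition kronecker (d : nat) : quiver :=
  @Quiver bool 'I_d (fun=> false) (fun=> true).

Section Representations.
Variable k : fieldType.

(* Finite dimensional representations of Q over k, up to isomorphism: the     *)
(* space at the vertex i is 'rV_(rdim i), and matrices act on the right of    *)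
(* row vectors. These are the finite dimensional left modules over the path   *)
(* algebra kQ, paths being composed like functions.                           *)
Record rep (Q : quiver) := Rep {
  rdim : vertex Q -> nat;
  rmap : forall a : arrow Q, 'M[k]_(rdim (src a), rdim (tgt a)) }.

Definition dimr (Q : quiver) (M : rep Q) : nat := (\sum_i rdim M i)%N.

Definition mxfam (Q : quiver) (M N : rep Q) : Type :=
  forall i : vertex Q, 'M[k]_(rdim M i, rdim N i).

Definition is_hom (Q : quiver) (M N : rep Q) (f : mxfam M N) : Prop :=
  forall a : arrow Q, rmap M a *m f (tgt a) = f (src a) *m rmap N a.

Definition is_epi (Q : quiver) (M N : rep Q) (f : mxfam M N) : Prop :=
  is_hom f /\ forall i, row_full (f i).

Definition isor (Q : quiver) (M N : rep Q) : Prop :=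
  exists f : mxfam M N,
    is_hom f /\ forall i, row_free (f i) && row_full (f i).

Definition rep0 (Q : quiver) : rep Q := @Rep Q (fun=> 0%N) (fun=> 0).

Definition dsum (Q : quiver) (M N : rep Q) : rep Q :=
  @Rep Q (fun i => (rdim M i + rdim N i)%N)
    (fun a => block_mx (rmap M a) 0 0 (rmap N a)).

Definition indecomposable (Q : quiver) (M : rep Q) : Prop :=
  (0 < dimr M)%N /\
  forall X Y : rep Q, isor M (dsum X Y) -> dimr X = 0%N \/ dimr Y = 0%N.

(* A family of subspaces is given by the row spaces of the U i. *)
Definition is_submodule (Q : quiver) (M : rep Q)
    (U : forall i, 'M[k]_(rdim M i)) : Prop :=
  forall a : arrow Q, (U (src a) *m rmap M a <= U (tgt a))%MS.

(* The submodule U as a representation, in the bases row_base (U i). *)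
Definition submodule (Q : quiver) (M : rep Q)
    (U : forall i, 'M[k]_(rdim M i)) : rep Q :=
  @Rep Q (fun i => \rank (U i))
    (fun a => row_base (U (src a)) *m rmap M a *m
              pinvmx (row_base (U (tgt a)))).

Definition projective (Q : quiver) (P : rep Q) : Prop :=
  forall (X Y : rep Q) (g : mxfam X Y) (f : mxfam P Y),
    is_epi g -> is_hom f ->
    exists h : mxfam P X, is_hom h /\ forall i, h i *m g i = f i.

Definition superfluous_kernel (Q : quiver) (M N : rep Q) (f : mxfam M N) :
    Prop :=
  forall U : (forall i, 'M[k]_(rdim M i)), is_submodule U ->
    (forall i, row_full (U i + kermx (f i))%MS) -> forall i, row_full (U i).

(* P1 -> P0 -> M -> 0 is exact, and both P0 -> M and P1 -> Ker (P0 -> M) are  *)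
(* projective covers.                                                         *)
Definition min_proj_pres (Q : quiver) (P1 P0 M : rep Q)
    (p1 : mxfam P1 P0) (p0 : mxfam P0 M) : Prop :=
  [/\ projective P1 /\ projective P0,
      is_hom p1 /\ is_epi p0,
      forall i, (p1 i == kermx (p0 i))%MS,
      superfluous_kernel p0 &
      superfluous_kernel p1].

(* Paths are listed in the order in which their arrows are traversed. In an   *)
(* acyclic quiver every path has fewer than #|vertex Q| arrows, so the bound  *)
(* on the length loses nothing; the definitions below are only meaningful for *)
(* acyclic Q.                                                                 *)
Fixpoint walk (Q : quiver) (i : vertex Q) (s : seq (arrow Q)) (j : vertex Q) :
    bool :=
  if s is a :: s' then (src a == i) && walk (tgt a) s' j else i == j.

Definition qpath (Q : quiver) (i j : vertex Q) : finType :=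
  {p : #|vertex Q|.-bseq (arrow Q) | walk i p j}.

Definition qpath_seq (Q : quiver) (i j : vertex Q) (p : qpath i j) :
    seq (arrow Q) := val p.

(* The left ideal A e_i of A := kQ, with basis the paths starting at i; an    *)
(* arrow acts by extending a path at its end.                                 *)
Definition left_ideal (Q : quiver) (i : vertex Q) : rep Q :=
  @Rep Q (fun j => #|qpath i j|)
    (fun b => \matrix_(x, y)
       (qpath_seq (enum_val y) == rcons (qpath_seq (enum_val x)) b)%:R).

(* Right multiplication by the arrow a, from A e_(tgt a) to A e_(src a). *)
Definition rmul (Q : quiver) (a : arrow Q) :
    mxfam (left_ideal (tgt a)) (left_ideal (src a)) :=
  fun j => \matrix_(x, y)
    (qpath_seq (enum_val y) == a :: qpath_seq (enum_val x))%:R.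
Arguments rmul {Q} a i.

(* N is isomorphic to Coker (Hom_A(p, A) : Hom_A(P0, A) -> Hom_A(P1, A)), a   *)
(* right A-module. The component of Hom_A(P, A) at the vertex i is            *)
(* Hom_A(P, A e_i), and an arrow a acts on it by composition with rmul a. The *)
(* maps Psi i form the quotient map from Hom_A(P1, A) onto N.                 *)
Definition is_coker_Hom_A (Q : quiver) (P1 P0 : rep Q) (p : mxfam P1 P0)
    (N : rep (opq Q)) : Prop :=
  exists Psi : forall i : vertex Q,
    mxfam P1 (left_ideal i) -> 'rV[k]_(rdim N i),
  [/\ forall (i : vertex Q) (c : k) (f g : mxfam P1 (left_ideal i)),
        is_hom f -> is_hom g ->
        Psi i (fun j => c *: f j + g j) = c *: Psi i f + Psi i g,
      forall (a : arrow Q) (f : mxfam P1 (left_ideal (tgt a))), is_hom f ->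
        Psi (src a) (fun j => f j *m rmul a j) = Psi (tgt a) f *m rmap N a,
      forall (i : vertex Q) (v : 'rV[k]_(rdim N i)),
        exists f : mxfam P1 (left_ideal i), is_hom f /\ Psi i f = v &
      forall (i : vertex Q) (f : mxfam P1 (left_ideal i)), is_hom f ->
        (Psi i f = 0 <->
         exists g : mxfam P0 (left_ideal i),
           is_hom g /\ forall j, f j = p j *m g j)].

(* N is isomorphic to the transpose Tr M. *)
Definition is_Tr (Q : quiver) (M : rep Q) (N : rep (opq Q)) : Prop :=
  exists (P1 P0 : rep Q) (p1 : mxfam P1 P0) (p0 : mxfam P0 M),
    min_proj_pres p1 p0 /\ is_coker_Hom_A p1 N.

(* The duality D = Hom_k(-, k). *)
Definition dualr (Q : quiver) (M : rep Q) : rep (opq Q) :=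
  @Rep (opq Q) (rdim M) (fun a => (rmap M a)^T).

(* The Auslander-Reiten translation is tau = D Tr, and tau^- = Tr D. *)
Definition is_tau_inv (Q : quiver) (M N : rep Q) : Prop :=
  @is_Tr (opq Q) (dualr M) N.

Fixpoint is_tau_inv_iter (Q : quiver) (r : nat) (M N : rep Q) : Prop :=
  if r is r'.+1 then
    exists X : rep Q, is_tau_inv_iter r' M X /\ is_tau_inv X N
  else isor M N.

Definition preprojective (Q : quiver) (M : rep Q) : Prop :=
  forall X Y : rep Q, isor M (dsum X Y) -> indecomposable X ->
  exists (r : nat) (P : rep Q),
    [/\ projective P, indecomposable P & is_tau_inv_iter r P X].

Definition hyperfinite (R : realType) (Q : quiver) (F : rep Q -> Prop) : Prop :=
  forall eps : R, 0 < eps ->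
  exists L : R, 0 < L /\
  forall M : rep Q, F M ->
  exists U : forall i, 'M[k]_(rdim M i),
    [/\ is_submodule U,
        (1 - eps) * (dimr M)%:R <= (dimr (submodule U))%:R &
        exists (t : nat) (N : 'I_t -> rep Q),
          (forall i, (dimr (N i))%:R <= L) /\
          isor (submodule U) (\big[@dsum Q/rep0 Q]_(i < t) N i)].

End Representations.

(* Main.v *)
Require Import Defs.
From mathcomp Require Import all_boot all_order all_algebra.
From mathcomp Require Import reals.
From mathcomp Require Import zify.
From Stdlib Require Import Classical.

(* To a representation V = (V1, V2) attach its reflection sigma V = (K, V1), where K  *)
(* is the kernel of V1^d -> V2, and let kdim J V be the dimension of (sigma^J V)_1,   *)
(* that is of Hom(P_J, V) for the J-th indecomposable preprojective P_J with nonzero  *)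
(* first component. Preprojectives are killed by a power of sigma, because sigma      *)
(* kills projectives at the vertex 1 and sigma^2 tau^- V embeds in V there. As        *)
(* dim K >= d dim V1 - dim V2 and d >= 3, dimensions then at least halve at each      *)
(* reflection, so that kdim J V <= 2^-J dim V1.                                       *)
(* A subspace of V1 of codimension kdim J V can be chosen to contain the image of no  *)
(* nonzero map P_J -> V. Together with V2 it spans a submodule with vanishing kdim J, *)
(* and undoing the reflections splits such a module into pieces of dimension at most  *)
(* (d + 1)^J.                                                                         *)

Set Implicit Arguments.
Unset Strict Implicit.
Unset Printing Implicit Defensive.

Import Order.TTheory GRing.Theory Num.Theory.
Local Open Scope ring_scope.

(** * Iterated reflections *)

Section Reflection.
Variables (k : fieldType) (d : nat).

Implicit Types x y n : nat.

(** One condition, [sigma_nilpotent], links the two halves of the argument: it holds for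
    preprojectives, and it yields bounds that depend on d and J alone. [kdim_halving] bounds
    [kdim J] by 2^-J dim V1 whatever the nilpotency index is, [kdim_cut] turns this number into the
    codimension of a submodule on which [kdim J] vanishes, and [kdim_eq0_splits] cuts that submodule
    into small pieces. [sigma_nilpotent_hyperfinite] takes 2^J at least 1/eps. For preprojectives,
    the condition starts from [projective_sigma_nilpotent], is carried along tau^- by
    [tau_inv_nilpotent], and passes to direct sums by [sigma_nilpotent_dsum]. *)

Definition stack x y (A : 'I_d -> 'M[k]_(x, y)) : 'M[k]_(\sum_(a < d) x, y) :=
  \mxcol_a A a.

Definition sdim x y (A : 'I_d -> 'M[k]_(x, y)) : nat :=
  \rank (kermx (stack A)).

Definition sigma x y (A : 'I_d -> 'M[k]_(x, y)) : 'I_d -> 'M[k]_(sdim A, x) :=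
  fun a => submxrow (row_base (kermx (stack A))) a.

Fixpoint kdim (J x y : nat) (A : 'I_d -> 'M[k]_(x, y)) : nat :=
  if J is J'.+1 then kdim J' (sigma A) else x.

Lemma rank_stack x y (A : 'I_d -> 'M[k]_(x, y)) :
  (\rank (stack A) + sdim A = d * x)%N.
Proof.
rewrite /sdim mxrank_ker subnKC ?rank_leq_row //.
by rewrite sum_nat_const card_ord.
Qed.

Lemma sigma_comp x y (A : 'I_d -> 'M[k]_(x, y)) :
  \sum_a sigma A a *m A a = 0.
Proof.
rewrite -mul_mxrow_mxcol submxrowK; apply/sub_kermxP.
by rewrite eq_row_base.
Qed.

Lemma sigmaP x y (A : 'I_d -> 'M[k]_(x, y)) n (W : 'I_d -> 'M_(n, x)) :
  \sum_a W a *m A a = 0 -> exists V, forall a, W a = V *m sigma A a.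
Proof.
rewrite -mul_mxrow_mxcol => /sub_kermxP; rewrite -(eq_row_base (kermx _)).
case/submxP => V eV; exists V => a.
by rewrite -[W a](mxrowK W) eV mul_submxrow.
Qed.

Lemma sigma_free x y (A : 'I_d -> 'M[k]_(x, y)) n (V : 'M_(n, _)) :
  (forall a, V *m sigma A a = 0) -> V = 0.
Proof.
move=> V0; apply: (row_free_inj (row_base_free (kermx (stack A)))).
rewrite /= mul0mx; apply/mxrowP => a.
by rewrite -mul_submxrow V0 submxrow0.
Qed.

Lemma sigma_hom x y (A : 'I_d -> 'M[k]_(x, y)) x' y'
    (A' : 'I_d -> 'M[k]_(x', y')) (f : 'M_(x', x)) (g : 'M_(y', y)) :
  (forall a, A' a *m g = f *m A a) ->
  exists h, forall a, sigma A' a *m f = h *m sigma A a.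
Proof.
move=> fg; apply: sigmaP.
rewrite (eq_bigr (fun a => sigma A' a *m A' a *m g)).
  by rewrite -mulmx_suml sigma_comp mul0mx.
by move=> a _; rewrite -!mulmxA fg.
Qed.

(* E evaluates maps P_J -> V at a suitable element of P_J, which is natural in V. *)
Lemma kdim_eval J x y (A : 'I_d -> 'M[k]_(x, y)) :
  exists E : 'M[k]_(kdim J A, x), ((0 < kdim J A)%N -> E != 0) /\
  forall x' y' (A' : 'I_d -> 'M_(x', y')) (f : 'M_(x', x)) (g : 'M_(y', y)),
    (forall a, A' a *m g = f *m A a) -> row_free f ->
    exists2 H : 'M_(kdim J A', kdim J A), row_free H & (H *m E <= f)%MS.
Proof.
elim: J x y A => [|J IH] x y A /=.
  exists 1%:M; split=> [x_gt0|x' y' A' f g _ ff].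
    by rewrite -mxrank_eq0 mxrank1 -lt0n.
  by exists f; rewrite // mulmx1.
have [E [E0 EP]] := IH _ _ (sigma A).
(* The maps [sigma A a] are jointly injective, so some coordinate a keeps E nonzero. It is chosen
   from A alone, before any f is given. *)
have [E' E'0 E'E] : exists2 E' : 'M_(kdim J (sigma A), x),
    (0 < kdim J (sigma A))%N -> E' != 0 &
    E' = 0 \/ exists a, E' = E *m sigma A a.
  have [_|/E0 {}E0] := posnP (kdim J (sigma A)).
    by exists 0; [|left].
  case: (pickP (fun a => E *m sigma A a != 0)) => [a Ea|Ea].
    by exists (E *m sigma A a) => //; right; exists a.
  by case/eqP: E0; apply: sigma_free => a; apply/eqP/negbFE/Ea.
exists E'; split=> // x' y' A' f g fg ff.
have [h hP] := sigma_hom fg.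
have fh : row_free h.
  apply/inj_row_free => v vh; apply: sigma_free => b.
  by apply: (row_free_inj ff); rewrite /= -mulmxA hP mulmxA vh !mul0mx.
have [H fH HE] := EP _ _ _ _ _ hP fh.
exists H => //; case: E'E => [->|[a ->]]; first by rewrite mulmx0 sub0mx.
rewrite mulmxA; apply: submx_trans (submxMr _ HE) _.
by rewrite -hP submxMl.
Qed.

(** Injectivity at the vertex 1 is enough, because sigma V is cut out of V1^d. *)
Lemma kdim_leq J x y (A : 'I_d -> 'M[k]_(x, y)) x' y'
    (A' : 'I_d -> 'M[k]_(x', y')) (f : 'M_(x', x)) (g : 'M_(y', y)) :
  (forall a, A' a *m g = f *m A a) -> row_free f ->
  (kdim J A' <= kdim J A)%N.
Proof.
move=> fg ff; have [E [_ EP]] := kdim_eval J A.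
have [H fH _] := EP _ _ _ _ _ fg ff.
by rewrite -(eqP fH) rank_leq_col.
Qed.

(* A hyperplane of V1 that does not contain the image of the evaluation E. *)
Lemma kdim_drop J x y (A : 'I_d -> 'M[k]_(x, y)) : (0 < kdim J A)%N ->
  exists x' (u : 'M[k]_(x', x)), [/\ row_free u, (x <= x'.+1)%N &
    (kdim J (fun a => u *m A a) < kdim J A)%N].
Proof.
move=> A0; have [E [/(_ A0)/matrix0Pn [i [j Eij]] EP]] := kdim_eval J A.
pose c : 'cV[k]_x := delta_mx j 0.
pose u := row_base (kermx c); exists _, u; split; first exact: row_base_free.
  rewrite mxrank_ker; have := rank_leq_col c; lia.
have [||H fH HE] := EP _ _ (fun a => u *m A a) u 1%:M.
- by move=> a; rewrite mulmx1.
- exact: row_base_free.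
(* If [kdim] did not drop, H would be invertible and E would land in the hyperplane where the j-th
   coordinate vanishes. *)
rewrite -(eqP fH) ltn_neqAle rank_leq_col andbT; apply/negP => rH.
have: (E <= u)%MS.
  by rewrite -(eqmxMfull E rH).
rewrite eq_row_base => /sub_kermxP /matrixP/(_ i 0).
rewrite !mxE (bigD1 j) //= big1 ?mxE ?eqxx => [|l lj]; last first.
  by rewrite !mxE (negPf lj) mulr0.
by rewrite mulr1 addr0 => /eqP; apply/negP.
Qed.

(** Each hyperplane from [kdim_drop] costs one dimension of V1 and lowers [kdim J] by at least
    one. *)
Lemma kdim_cut J x y (A : 'I_d -> 'M[k]_(x, y)) :
  exists x' (u : 'M[k]_(x', x)), [/\ row_free u, (x <= x' + kdim J A)%N &
    kdim J (fun a => u *m A a) = 0%N].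
Proof.
have [n] := ubnP (kdim J A); elim: n x A => // n IH x A An.
have [A0|/kdim_drop [x1 [u [fu x1P uA]]]] := posnP (kdim J A).
  exists x, 1%:M; split; rewrite ?row_free_unit ?unitmx1 ?leq_addr //.
  apply/eqP; rewrite -leqn0 -A0.
  apply: (@kdim_leq _ _ _ _ _ _ _ 1%:M 1%:M); rewrite ?row_free_unit ?unitmx1 //.
  by move=> a; rewrite mulmx1.
have [x2 [v [fv x2P vA]]] := IH _ _ (leq_trans uA An).
exists x2, (v *m u); split.
- by rewrite /row_free mxrankMfree.
- lia.
apply/eqP; rewrite -leqn0 -vA.
apply: (@kdim_leq _ _ _ _ _ _ _ 1%:M 1%:M); rewrite ?row_free_unit ?unitmx1 //.
by move=> a; rewrite mulmx1 mul1mx mulmxA.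
Qed.

Lemma sdim_leq x y (A : 'I_d -> 'M[k]_(x, y)) : (d * x <= y + sdim A)%N.
Proof. by rewrite -(rank_stack A) leq_add2r rank_leq_col. Qed.

Lemma kdim_eq0S J x y (A : 'I_d -> 'M[k]_(x, y)) :
  kdim J A = 0%N -> kdim J.+1 A = 0%N.
Proof.
elim: J x y A => [|J IH] x y A /=; last exact: IH.
by move=> x0; have := rank_stack A; nia.
Qed.

Hypothesis d_ge3 : (3 <= d)%N.

(** Going back along the reflections, 2 dim K <= dim V1 and dim K >= d dim V1 - dim V2 give dim V2
    >= (d - 1/2) dim V1, and d >= 3. *)
Lemma kdim_eq0_leq J x y (A : 'I_d -> 'M[k]_(x, y)) :
  kdim J A = 0%N -> (2 * x <= y)%N.
Proof.
elim: J x y A => [|J IH] x y A /=; first by move=> ->.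
by move/IH; have := sdim_leq A; nia.
Qed.

(** [kdim_eq0_leq] for [sigma A] reads 2 dim K <= dim V1. The index I does not enter the bound,
    which makes it uniform over the family. *)
Lemma kdim_halving I J x y (A : 'I_d -> 'M[k]_(x, y)) :
  kdim I A = 0%N -> (2 ^ J * kdim J A <= x)%N.
Proof.
elim: J x y A => [|J IH] x y A /=; first by rewrite mul1n.
move/kdim_eq0S => /= A0; rewrite expnS -mulnA.
have := kdim_eq0_leq A0; have := IH _ _ _ A0; lia.
Qed.

(* If C is the common kernel then (C, 0) is a subrepresentation, so 2 dim C <= 0. *)
Lemma kdim_eq0_free J x y (A : 'I_d -> 'M[k]_(x, y)) n (v : 'M_(n, x)) :
  kdim J A = 0%N -> (forall a, v *m A a = 0) -> v = 0.
Proof.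
move=> A0 vA; apply/eqP; rewrite -mxrank_eq0.
suff: (2 * \rank v <= 0)%N by lia.
pose Z (a : 'I_d) : 'M[k]_(\rank v, 0) := 0.
apply: (@kdim_eq0_leq J _ _ Z); apply/eqP; rewrite -leqn0.
apply: leq_trans (_ : kdim J A <= 0)%N; last by rewrite A0.
apply: (@kdim_leq _ _ _ _ _ _ _ (row_base v) 0); rewrite ?row_base_free // => a.
have /submxP[D ->] : (row_base v <= v)%MS by rewrite eq_row_base.
by rewrite -mulmxA vA !mulmx0.
Qed.

(** Joint injectivity at the vertex 1 is inherited by the reflections. Applied to the two
    projections of a direct sum, this spares computing its reflection. *)
Lemma kdim_joint J x y (A : 'I_d -> 'M[k]_(x, y))
    x1 y1 (A1 : 'I_d -> 'M[k]_(x1, y1)) (f1 : 'M_(x, x1)) (g1 : 'M_(y, y1))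
    x2 y2 (A2 : 'I_d -> 'M[k]_(x2, y2)) (f2 : 'M_(x, x2)) (g2 : 'M_(y, y2)) :
  (forall a, A a *m g1 = f1 *m A1 a) -> (forall a, A a *m g2 = f2 *m A2 a) ->
  row_free (row_mx f1 f2) -> (kdim J A <= kdim J A1 + kdim J A2)%N.
Proof.
elim: J x y A x1 y1 A1 f1 g1 x2 y2 A2 f2 g2 =>
    [|J IH] x y A x1 y1 A1 f1 g1 x2 y2 A2 f2 g2 fg1 fg2 ff /=.
  by rewrite -(eqP ff) rank_leq_col.
have [h1 h1P] := sigma_hom fg1; have [h2 h2P] := sigma_hom fg2.
apply: (IH _ _ _ _ _ _ _ _ _ _ _ _ _ h1P h2P).
apply/inj_row_free => v; rewrite mul_mx_row => /eqP.
rewrite row_mx_eq0 => /andP[/eqP vh1 /eqP vh2]; apply: sigma_free => a.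
apply: (row_free_inj ff); rewrite /= mul0mx mul_mx_row -!mulmxA h1P h2P.
by rewrite !mulmxA vh1 vh2 !mul0mx row_mx0.
Qed.
End Reflection.

(** * Splitting representations killed by a power of sigma *)

Section Splitting.
Variables (k : fieldType) (d : nat).

Lemma stack_sub x y (A : 'I_d -> 'M[k]_(x, y)) n (X : 'M_(n, y)) :
  (forall a, (A a <= X)%MS) <-> (stack A <= X)%MS.
Proof.
have e : stack A *m cokermx X = \mxcol_a (A a *m cokermx X) by rewrite mxcol_mul.
rewrite [in X in _ <-> X]submxE e; split=> [AX|/eqP AX a].
  apply/eqP/mxcolP => a; rewrite mxcolK submxcol0.
  by apply/eqP; rewrite -submxE.
by rewrite submxE -[_ *m _](mxcolK (fun a => A a *m cokermx X)) AX submxcol0.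
Qed.

(* The two bounds on the sums of ranks make the sums direct. *)
Definition splits (L x y : nat) (A : 'I_d -> 'M[k]_(x, y)) : Prop :=
  exists (T : finType) (V : T -> 'M[k]_x) (W : T -> 'M[k]_y),
  [/\ forall t a, (V t *m A a <= W t)%MS,
      (1%:M <= \sum_t V t)%MS /\ (1%:M <= \sum_t W t)%MS,
      (\sum_t \rank (V t) <= x)%N /\ (\sum_t \rank (W t) <= y)%N &
      forall t, (\rank (V t) + \rank (W t) <= L)%N].

Lemma line_sum n y (C : 'M[k]_(n, y)) : (C <= \sum_j <<row j C>>)%MS.
Proof.
by apply/row_subP => j; apply: (sumsmx_sup j) => //; rewrite genmxE.
Qed.

(* W t is the component of V1 and V t that of K: the image of (W t)^d in V2 has     *)
(* dimension at most d dim (W t) - dim (V t), and these bounds add up to the rank of  *)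
(* V1^d -> V2, so that the images form a direct sum.                                  *)
Lemma splits_step L x y (A : 'I_d -> 'M[k]_(x, y)) : (0 < L)%N ->
  splits L (sigma A) -> splits (d.+1 * L) A.
Proof.
move=> L0 [T [V [W [VW [V1 W1] [rV rW] VL]]]].
pose w t := row_base (W t).
(* A complement of the image of V1^d in V2; it is split into lines, each a simple summand at the
   vertex 2. *)
pose C := row_base ((stack A)^C)%MS.
pose V' (s : T + 'I_(\rank ((stack A)^C)%MS)) := if s is inl t then W t else 0.
pose W' (s : T + 'I_(\rank ((stack A)^C)%MS)) :=
  match s with inl t => <<stack (fun a => w t *m A a)>>%MS
             | inr j => <<row j C>>%MS end.
have sub t a : (W t *m A a <= W' (inl t))%MS.
  rewrite genmxE; apply: submx_trans (_ : _ <= w t *m A a)%MS _.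
    by rewrite submxMr ?eq_row_base.
  by apply/(stack_sub (fun a => w t *m A a) (stack _)): a; apply: submx_refl.
have rk t : (\rank (W' (inl t)) + \rank (V t) <= d * \rank (W t))%N.
  rewrite genmxE -(rank_stack (fun a => w t *m A a)) leq_add2l.
  have eQ a : row_base (V t) *m sigma A a =
      row_base (V t) *m sigma A a *m pinvmx (w t) *m w t.
    rewrite mulmxKpV // eq_row_base; apply: submx_trans (VW t a).
    by rewrite submxMr ?eq_row_base.
  (* Z embeds V t into the kernel of (W t)^d -> V2. *)
  have [|Z ZP] := @sigmaP _ _ _ _ (fun a => w t *m A a) _
      (fun a => row_base (V t) *m sigma A a *m pinvmx (w t)).
    rewrite (eq_bigr (fun a => row_base (V t) *m (sigma A a *m A a))).
      by rewrite -mulmx_sumr sigma_comp mulmx0.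
    by move=> a _; rewrite [in LHS]mulmxA -eQ -mulmxA.
  have fZ : row_free Z.
    apply/inj_row_free => v vZ.
    apply: (row_free_inj (row_base_free (V t))); rewrite /= mul0mx.
    apply: sigma_free => a; rewrite -mulmxA eQ ZP 2!mulmxA vZ !mul0mx //.
  by rewrite -(eqP fZ) rank_leq_col.
exists (T + 'I_(\rank ((stack A)^C)%MS))%type, V', W'; split.
- by move=> [t|j] a; [exact: sub | rewrite mul0mx sub0mx].
- rewrite !big_sumType /=; split.
    by apply: submx_trans W1 _; apply: addsmxSl.
  have: row_full (stack A + (stack A)^C)%MS by apply: addsmx_compl_full.
  rewrite -sub1mx => /submx_trans; apply; apply: addsmxS; last first.
    by apply: submx_trans (line_sum C); rewrite eq_row_base.
  apply/stack_sub => a; rewrite -[A a]mul1mx.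
  apply: submx_trans (submxMr _ W1) _; rewrite sumsmxMr_gen.
  by apply/sumsmx_subP => t _; apply: (sumsmx_sup t); rewrite // genmxE sub.
- rewrite !big_sumType /=; split.
    by rewrite [X in (_ + X)%N]big1 ?addn0 // => j _; rewrite mxrank0.
  have rC : (\sum_j \rank (W' (inr j)) <= \rank ((stack A)^C)%MS)%N.
    apply: leq_trans (_ : \sum_(j < \rank ((stack A)^C)%MS) 1 <= _)%N.
      by apply: leq_sum => j _; rewrite genmxE rank_leq_row.
    by rewrite sum1_card card_ord.
  have rT : (\sum_t \rank (W' (inl t)) + \sum_t \rank (V t) <= d * x)%N.
    rewrite -big_split /=; apply: leq_trans (_ : \sum_t d * \rank (W t) <= _)%N.
      by apply: leq_sum => t _; exact: rk.
    by rewrite -big_distrr leq_mul2l rW orbT.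
  have rV' : (sdim A <= \sum_t \rank (V t))%N.
    rewrite -{1}(mxrank1 k (sdim A)); apply: leq_trans (mxrankS V1) _.
    by apply: mxrank_sum_leqif.
  have := mxrank_compl (stack A); have := rank_stack A.
  have := rank_leq_col (stack A).
  move: rC rT rV'; rewrite /W' /=; lia.
- have le t := VL t; move=> [t|j]; last first.
    rewrite mxrank0 add0n genmxE; apply: leq_trans (rank_leq_row _) _.
    by rewrite muln_gt0.
  have := rk t; have := VL t; rewrite /=; nia.
Qed.

(** For J = 0 the space V1 is zero and V2 splits into lines; each undone reflection multiplies the
    size by at most d + 1. *)
Lemma kdim_eq0_splits J x y (A : 'I_d -> 'M[k]_(x, y)) :
  kdim J A = 0%N -> splits (d.+1 ^ J) A.
Proof.
elim: J x y A => [|J IH] x y A /= A0; last first.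
  by rewrite expnS; apply: splits_step (IH _ _ _ A0); rewrite expn_gt0.
exists 'I_y, (fun=> 0), (fun j => <<row j 1%:M>>%MS); split.
- by move=> t a; rewrite mul0mx sub0mx.
- split; last exact: line_sum.
  by apply/row_subP => i; have := ltn_ord i; lia.
- split; first by rewrite big1 // => i _; rewrite mxrank0.
  apply: leq_trans (_ : \sum_(j < y) 1 <= _)%N; last by rewrite sum1_card card_ord.
  by apply: leq_sum => j _; rewrite genmxE rank_leq_row.
- by move=> t; rewrite mxrank0 genmxE rank_leq_row.
Qed.
End Splitting.

(** * Isomorphisms and direct sums *)

Section Isomorphism.
Variables (k : fieldType) (Q : quiver).
Implicit Types M N X Y : rep k Q.

Lemma isor_inv M N (F : mxfam N M) :
  is_hom F -> (forall i, row_free (F i) && row_full (F i)) -> isor M N.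
Proof.
move=> hF fF; exists (fun i => pinvmx (F i)); split=> [a|i]; last first.
  by case/andP: (fF i) => Fi1 Fi2; rewrite pinvmx_full // pinvmx_free.
have /andP[_ Fs] := fF (src a); have /andP[Ft _] := fF (tgt a).
by rewrite -[LHS](mul1mx) -(mulVpmx Fs) -mulmxA (mulmxA (F _)) -hF mulmxKp.
Qed.

Lemma isor_sym M N : isor M N -> isor N M.
Proof. by case=> F [hF fF]; apply: isor_inv hF fF. Qed.

Lemma isor_dsumP M X Y :
  isor M (dsum X Y) <->
  exists (p : mxfam M X) (q : mxfam M Y), [/\ is_hom p, is_hom q,
    forall i, row_free (row_mx (p i) (q i)) &
    forall i, rdim M i = (rdim X i + rdim Y i)%N].
Proof.
split=> [[F [hF fF]]|[p [q [hp hq fpq dM]]]].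
  exists (fun i => lsubmx (F i)), (fun i => rsubmx (F i)); split=> [a|a|i|i].
  - have := congr1 lsubmx (hF a).
    rewrite /= -{1}(hsubmxK (F (src a))) mul_row_block !mulmx0 addr0 add0r.
    by rewrite row_mxKl => <-; rewrite -{2}(hsubmxK (F (tgt a))) mul_mx_row row_mxKl.
  - have := congr1 rsubmx (hF a).
    rewrite /= -{1}(hsubmxK (F (src a))) mul_row_block !mulmx0 addr0 add0r.
    by rewrite row_mxKr => <-; rewrite -{2}(hsubmxK (F (tgt a))) mul_mx_row row_mxKr.
  - by rewrite hsubmxK; case/andP: (fF i).
  - by case/andP: (fF i) => /eqP rM /eqP; rewrite rM.
exists (fun i => row_mx (p i) (q i)); split=> [a|i].
  by rewrite /= mul_mx_row mul_row_block !mulmx0 addr0 add0r hp hq.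
by rewrite fpq /row_full (eqP (fpq i)) dM eqxx.
Qed.

Lemma incl_hom M (U : forall i, 'M[k]_(rdim M i)) :
  is_submodule U -> @is_hom k Q (submodule U) M (fun i => row_base (U i)).
Proof.
move=> sU a; rewrite /= mulmxKpV // eq_row_base; apply: submx_trans (sU a).
by rewrite submxMr ?eq_row_base.
Qed.

Lemma rdim_bigdsum (I : Type) (r : seq I) (N : I -> rep k Q) i :
  rdim (\big[@dsum k Q/rep0 k Q]_(t <- r) N t) i = (\sum_(t <- r) rdim (N t) i)%N.
Proof. exact: (big_morph (fun M => rdim M i)). Qed.

Lemma bigdsum_hom (I : eqType) (r : seq I) M (N : I -> rep k Q)
    (f : forall t, mxfam (N t) M) :
  (forall t, is_hom (f t)) ->
  exists F : mxfam (\big[@dsum k Q/rep0 k Q]_(t <- r) N t) M,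
    is_hom F /\ forall i t, t \in r -> (f t i <= F i)%MS.
Proof.
move=> hf; elim: r => [|s r [F [hF fF]]].
  by rewrite big_nil; exists (fun=> 0); split=> // a; rewrite mulmx0 mul0mx.
rewrite big_cons; exists (fun i => col_mx (f s i) (F i)); split=> [a|i t].
  by rewrite /= mul_block_col mul_col_mx !mul0mx addr0 add0r hf hF.
rewrite inE -addsmxE => /predU1P[->|/(fF i) tF]; first exact: addsmxSl.
exact: submx_trans tF (addsmxSr _ _).
Qed.

(** The inclusions add up to a map from the direct sum onto M, and the bound on the ranks forces it
    to be injective. *)
Lemma isor_bigdsum M (T : finType) (U : T -> forall i, 'M[k]_(rdim M i)) :
  (forall t, is_submodule (U t)) ->
  (forall i, (1%:M <= \sum_t U t i)%MS) ->
  (forall i, (\sum_t \rank (U t i) <= rdim M i)%N) ->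
  isor M (\big[@dsum k Q/rep0 k Q]_(j < #|T|) submodule (U (enum_val j))).
Proof.
move=> sU U1 rU.
have [F [hF fF]] := bigdsum_hom (index_enum 'I_#|T|)
  (fun j => incl_hom (sU (enum_val j))).
have full i : row_full (F i).
  rewrite -sub1mx; apply: submx_trans (U1 i) _; apply/sumsmx_subP => t _.
  rewrite -(eq_row_base (U t i)) -(enum_rankK t).
  by apply: fF; rewrite mem_index_enum.
apply: (isor_inv hF) => i; rewrite full andbT /row_free (eqP (full i)) eqn_leq.
rewrite -{1}(eqP (full i)) rank_leq_row rdim_bigdsum /=.
by rewrite -(big_enum_val (fun t => \rank (U t i))) rU.
Qed.
End Isomorphism.

(** * Hyperfiniteness of sigma-nilpotent representations *)

Section Hyperfinite.
Variables (k : fieldType) (d : nat).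
Hypothesis d_ge3 : (3 <= d)%N.

Definition kmap (M : rep k (kronecker d)) :
    'I_d -> 'M[k]_(rdim M false, rdim M true) := fun a => rmap M a.

Definition sigma_nilpotent (M : rep k (kronecker d)) : Prop :=
  exists J, kdim J (kmap M) = 0%N.

Lemma sigma_nilpotent_hyperfinite (R : realType) : hyperfinite R sigma_nilpotent.
Proof.
move=> e e0; pose J := Num.bound e^-1.
have Je : 1 <= e * (2 ^ J)%N%:R :> R.
  rewrite -{1}(mulfV (lt0r_neq0 e0)) ler_pM2l //.
  apply: le_trans (ltW (archi_boundP _)) _; first by rewrite invr_ge0 ltW.
  by rewrite ler_nat ltnW // ltn_expl.
exists (d.+1 ^ J)%N%:R; split; first by rewrite ltr0n expn_gt0.
move=> M [I MI]; have [x [u [fu xP uM]]] := kdim_cut J (kmap M).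
(* All of V2 is kept, so any subspace of V1 gives a submodule; the loss is at most [kdim J], hence
   at most eps dim M. *)
pose U (i : vertex (kronecker d)) : 'M[k]_(rdim M i) :=
  match i as b return 'M[k]_(rdim M b) with false => <<u>>%MS | true => 1%:M end.
have sU : is_submodule U by move=> a; rewrite /= submx1.
exists U; split=> //.
  have dimE (N : rep k (kronecker d)) : dimr N = (rdim N true + rdim N false)%N.
    by rewrite /dimr big_bool.
  have h : (2 ^ J * (rdim M false) <= 2 ^ J * x + dimr M)%N.
    by have := kdim_halving d_ge3 J MI; rewrite dimE; nia.
  rewrite mulrBl mul1r lerBlDr; apply: le_trans
    (_ : (dimr (submodule U))%:R + (rdim M false - x)%:R <= _).
    rewrite -natrD ler_nat !dimE /= mxrank1 mxrank_gen (eqP fu); lia.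
  rewrite lerD2l -(ler_pM2l (_ : 0 < (2 ^ J)%N%:R)) ?ltr0n ?expn_gt0 //.
  apply: le_trans (_ : (dimr M)%:R <= _).
    by rewrite -natrM ler_nat mulnBr leq_subLR.
  by rewrite mulrA [_ * e]mulrC ler_peMl.
pose S := submodule U.
(* S is written in a basis of the row space of u other than u itself, so [kdim_leq] transfers the
   vanishing. *)
have SJ : kdim J (kmap S) = 0%N.
  have sub : (row_base (U false) <= u)%MS by rewrite eq_row_base genmxE.
  apply/eqP; rewrite -leqn0 -uM; have /submxP[D eD] := sub.
  apply: (@kdim_leq _ _ _ _ _ _ _ _ _ D (row_base (U true))).
    by move=> a; rewrite mulmxA -eD (incl_hom sU).
  apply/inj_row_free => v vD; apply: (row_free_inj (row_base_free (U false))).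
  by rewrite /= eD mulmxA vD !mul0mx.
have [T [V [W [VW [V1 W1] [rV rW] VL]]]] := kdim_eq0_splits SJ.
pose P t (i : vertex (kronecker d)) : 'M[k]_(rdim S i) :=
  match i as b return 'M[k]_(rdim S b) with false => V t | true => W t end.
exists #|T|, (fun j => submodule (P (enum_val j))); split.
  by move=> j; rewrite ler_nat /dimr big_bool /= addnC.
by apply: isor_bigdsum => [t a|[]|[]] //=; apply: VW.
Qed.
End Hyperfinite.

(** * Projective representations *)

Section Projective.
Variables (k : fieldType) (d : nat).

(** The value false gives [kronecker d] and true its opposite, so that one lemma on projectives
    serves both. *)
Definition kron (s : bool) : quiver :=
  @Quiver bool 'I_d (fun=> s) (fun=> ~~ s).

Definition unit_block p (a : 'I_d) : 'M[k]_(p, \sum_(b < d) p) :=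
  \mxrow_b (if a == b then 1%:M else 0).

Lemma sum_unit_block n p (W : 'I_d -> 'M[k]_(n, p)) :
  \sum_a W a *m unit_block p a = \mxrow_a W a.
Proof.
apply/mxrowP => b; rewrite mxrowK submxrow_sum.
transitivity (\sum_a W a *m (if a == b then 1%:M else 0)).
  by apply: eq_bigr => a _; rewrite -mul_submxrow mxrowK.
rewrite (bigD1 b) //= big1 ?addr0 ?eqxx ?mulmx1 // => a /negPf ->.
by rewrite mulmx0.
Qed.

(* Lift P -> (P_s, 0) along the free representation (P_s, P_s^d) -> (P_s, 0). *)
Lemma projective_stack_free s (P : rep k (kron s)) : projective P ->
  row_free (stack (fun a => rmap P a : 'M_(rdim P s, rdim P (~~ s)))).
Proof.
suff H : projective P ->
    exists h : 'M_(rdim P (~~ s), \sum_(b < d) rdim P s),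
      forall a : 'I_d, (rmap P a : 'M_(rdim P s, rdim P (~~ s))) *m h
                       = unit_block (rdim P s) a.
  move=> /H [h hP]; apply/row_freeP; exists h.
  rewrite mxcol_mul; transitivity (\mxcol_a unit_block (rdim P s) a).
    by apply/mxcolP => a; rewrite !mxcolK hP.
  rewrite -[LHS]mul1mx -[X in X *m _]submxrowK mul_mxrow_mxcol.
  by rewrite sum_unit_block submxrowK.
pose p := rdim P s; pose q := (\sum_(b < d) p)%N.
case: s P @p @q => P p q projP.
- pose X : rep k (kron true) :=
    @Rep k (kron true) (fun b : bool => if b then p else q) (unit_block p).
  pose Y : rep k (kron true) :=
    @Rep k (kron true) (fun b : bool => if b then p else 0%N) (fun=> 0).
  pose g : mxfam X Y := fun b : bool => match b as b0
    return 'M[k]_(rdim X b0, rdim Y b0) with true => 1%:M | false => 0 end.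
  pose f : mxfam P Y := fun b : bool => match b as b0
    return 'M[k]_(rdim P b0, rdim Y b0) with true => 1%:M | false => 0 end.
  have [||h [hh hg]] := projP X Y g f.
  + split=> [a|[]]; first by rewrite /= mulmx0 mul1mx.
    * by rewrite /= row_full_unit unitmx1.
    * by rewrite /row_full mxrank0.
  + by move=> a; rewrite /= mulmx0 mul1mx.
  exists (h false) => a; have /= -> := hh a.
  by have /= := hg true; rewrite mulmx1 => ->; rewrite mul1mx.
- pose X : rep k (kron false) :=
    @Rep k (kron false) (fun b : bool => if b then q else p) (unit_block p).
  pose Y : rep k (kron false) :=
    @Rep k (kron false) (fun b : bool => if b then 0%N else p) (fun=> 0).
  pose g : mxfam X Y := fun b : bool => match b as b0
    return 'M[k]_(rdim X b0, rdim Y b0) with true => 0 | false => 1%:M end.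
  pose f : mxfam P Y := fun b : bool => match b as b0
    return 'M[k]_(rdim P b0, rdim Y b0) with true => 0 | false => 1%:M end.
  have [||h [hh hg]] := projP X Y g f.
  + split=> [a|[]]; first by rewrite /= mulmx0 mul1mx.
    * by rewrite /row_full mxrank0.
    * by rewrite /= row_full_unit unitmx1.
  + by move=> a; rewrite /= mulmx0 mul1mx.
  exists (h true) => a; have /= -> := hh a.
  by have /= := hg false; rewrite mulmx1 => ->; rewrite mul1mx.
Qed.

Lemma projective_sigma_nilpotent (P : rep k (kronecker d)) :
  projective P -> sigma_nilpotent P.
Proof.
move=> /(@projective_stack_free false) fP; exists 1%N => /=.
rewrite /sdim; apply/eqP; rewrite mxrank_eq0 kermx_eq0; exact: fP.
Qed.


(** Relations among the B a come from C, and relations among the C a come from A. Lifting twice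
    gives a morphism (Z, Y) from sigma^2 B to A, and Z is injective because both reflections are
    jointly injective. *)
Lemma kdim_shift2 J x y (A : 'I_d -> 'M[k]_(x, y)) x' y'
    (B : 'I_d -> 'M[k]_(x', y')) (C : 'I_d -> 'M[k]_(y, x')) :
  (forall n (W : 'I_d -> 'M_(n, x')), \sum_a W a *m B a = 0 ->
    exists V, forall a, W a = V *m C a) ->
  (forall n (W : 'I_d -> 'M_(n, y)), \sum_a W a *m C a = 0 ->
    exists V, forall a, W a = V *m A a) ->
  (kdim J.+2 B <= kdim J A)%N.
Proof.
move=> BC CA; have [Y YP] := BC _ _ (sigma_comp B).
have [|Z ZP] := CA _ (fun a => sigma (sigma B) a *m Y).
  rewrite -[RHS](sigma_comp (sigma B)); apply: eq_bigr => a _.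
  by rewrite -mulmxA -YP.
apply: (@kdim_leq _ _ _ _ _ _ _ _ _ Z Y) => //.
apply/inj_row_free => v vZ; apply: sigma_free => a; apply: sigma_free => b.
by rewrite YP mulmxA -(mulmxA v) ZP mulmxA vZ !mul0mx.
Qed.
End Projective.

(** * The inverse Auslander-Reiten translation *)

Section OppositePaths.
Variables (k : fieldType) (d : nat).
Local Notation O := (opq (kronecker d)).

Lemma qpath_falseP (p : qpath (Q := O) false false) : qpath_seq p = [::].
Proof. by case: p => -[[|a s] ps]. Qed.

Lemma qpath_trueP (p : qpath (Q := O) true true) : qpath_seq p = [::].
Proof. by case: p => -[[|a [|b s]] ps]. Qed.

Lemma card_qpath_false_true : #|qpath (Q := O) false true| = 0%N.
Proof. by apply: eq_card0 => -[[[|a s] ps]]. Qed.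

Definition qnil (i : vertex O) : qpath (Q := O) i i := exist _ [bseq] (eqxx i).

Lemma qarrow_size (a : 'I_d) : (size [:: a] <= #|vertex O|)%N.
Proof. by rewrite card_bool. Qed.

Definition qarrow (a : 'I_d) : qpath (Q := O) true false :=
  exist _ (Bseq (qarrow_size a)) isT.

Lemma left_ideal_arrow (a b : 'I_d) x :
  @rmap k O (left_ideal k (Q := O) true) a x (enum_rank (qarrow b)) = (a == b)%:R.
Proof. by rewrite !mxE qpath_trueP enum_rankK /= eqseq_cons andbT eq_sym. Qed.

Lemma rmul_arrow (a b : 'I_d) x :
  rmul k (Q := O) a false x (enum_rank (qarrow b)) = (a == b)%:R.
Proof. by rewrite !mxE qpath_falseP enum_rankK /= eqseq_cons andbT eq_sym. Qed.

Lemma eq_left_ideal_false m (A B : 'M[k]_(m, #|qpath (Q := O) false true|)) : A = B.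
Proof.
by apply/matrixP => i j; have := ltn_ord j; rewrite {2}card_qpath_false_true.
Qed.
End OppositePaths.

Section LinearOnHoms.
Variables (k : fieldType) (Q : quiver) (P X : rep k Q) (n : nat).
Variable L : mxfam P X -> 'rV[k]_n.
Hypothesis L_lin : forall (c : k) (f g : mxfam P X), is_hom f -> is_hom g ->
  L (fun j => c *: f j + g j) = c *: L f + L g.
Hypothesis L_0 : forall f, is_hom f -> (forall j, f j = 0) -> L f = 0.

(** Families of matrices that agree pointwise need not be equal as functions; linearity reduces the
    claim to families that vanish pointwise. *)
Lemma lin_ext f g : is_hom f -> is_hom g -> (forall j, f j = g j) -> L f = L g.
Proof.
move=> hf hg fg; apply/eqP; rewrite eq_sym -subr_eq0 -scaleN1r addrC -L_lin //.
apply/eqP/L_0 => [a|j]; last by rewrite fg scaleN1r addNr.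
by rewrite !fg scaleN1r addNr scaleN1r addNr mulmx0 mul0mx.
Qed.

Lemma is_hom_sum (I : Type) (r : seq I) (c : I -> k) (f : I -> mxfam P X) :
  (forall a, is_hom (f a)) -> is_hom (fun j => \sum_(a <- r) c a *: f a j).
Proof.
move=> hf b; rewrite mulmx_sumr mulmx_suml; apply: eq_bigr => a _.
by rewrite -scalemxAr -scalemxAl hf.
Qed.

Lemma lin_sum (I : Type) (r : seq I) (c : I -> k) (f : I -> mxfam P X) :
  (forall a, is_hom (f a)) ->
  L (fun j => \sum_(a <- r) c a *: f a j) = \sum_(a <- r) c a *: L (f a).
Proof.
move=> hf; elim: r => [|a r IH].
  rewrite big_nil; apply: L_0; first exact: is_hom_sum.
  by move=> j; rewrite big_nil.
rewrite big_cons -IH -L_lin //; last exact: is_hom_sum.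
apply: lin_ext => [||j]; last by rewrite big_cons.
  exact: is_hom_sum.
by have := is_hom_sum (a :: r) c hf => H b; have := H b; rewrite !big_cons.
Qed.
End LinearOnHoms.

Section Transpose.
Variables (k : fieldType) (d : nat).
Local Notation O := (opq (kronecker d)).

Definition opmap (P : rep k O) : 'I_d -> 'M[k]_(rdim P true, rdim P false) :=
  fun a => rmap P a.

(* With F = false and T = true: as P1_T = 0, Hom(P1, A e_F) consists of the columns   *)
(* of height dim P1_F; Theta identifies it with N_F.                                  *)
Lemma coker_coords (P1 P0 : rep k O) (p1 : mxfam P1 P0) (N : rep k (kronecker d))
    (R : 'I_d -> 'M[k]_(rdim P1 false, rdim P0 true)) :
  rdim P1 true = 0%N ->
  row_full (stack (opmap P0)) ->
  p1 false = \sum_a R a *m opmap P0 a ->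
  @is_coker_Hom_A k O P1 P0 p1 N ->
  exists Theta : 'M[k]_(rdim P1 false, rdim N false),
  [/\ row_free Theta, row_full Theta &
      forall u : 'I_d -> 'rV_(rdim P1 false),
        \sum_a u a *m Theta *m kmap N a = 0 ->
        exists g : 'cV_(rdim P0 true), forall a, (u a)^T = R a *m g].
Proof.
move=> P1T P0full p1R [Psi [Psi_lin Psi_arr Psi_surj Psi_ker]].
pose AF := left_ideal k (Q := O) false.
pose AT := left_ideal k (Q := O) true.
have P1T0 n (A B : 'M[k]_(rdim P1 true, n)) : A = B.
  by apply/matrixP => i j; have := ltn_ord i; rewrite {2}P1T.
have homAF (f : mxfam P1 AF) : is_hom f by move=> a; apply: P1T0.
have homAT (f : mxfam P1 AT) : is_hom f by move=> a; apply: P1T0.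
have L0 i (f : mxfam P1 (left_ideal k (Q := O) i)) :
    is_hom f -> (forall j, f j = 0) -> Psi i f = 0.
  move=> hf f0; apply/Psi_ker => //; exists (fun=> 0); split=> [a|j].
    by rewrite mulmx0 mul0mx.
  by rewrite f0 mulmx0.
pose x0 : 'I_#|qpath (Q := O) false false| := enum_rank (@qnil d false).
pose y0 : 'I_#|qpath (Q := O) true true| := enum_rank (@qnil d true).
have x0P x : x = x0.
  apply: enum_val_inj; apply: val_inj; apply: val_inj.
  exact: etrans (qpath_falseP _) (esym (qpath_falseP _)).
have y0P x : x = y0.
  apply: enum_val_inj; apply: val_inj; apply: val_inj.
  exact: etrans (qpath_trueP _) (esym (qpath_trueP _)).
pose phi (c : 'cV[k]_(rdim P1 false)) : mxfam P1 AF := fun b : bool =>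
  match b as b0 return 'M[k]_(rdim P1 b0, rdim AF b0) with
  | true => 0 | false => \matrix_(i, j) c i 0 end.
pose Theta := \matrix_i Psi false (phi (delta_mx i 0)).
have ThetaP (u : 'rV_(rdim P1 false)) : u *m Theta = Psi false (phi u^T).
  rewrite mulmx_sum_row.
  rewrite (eq_bigr (fun i => u 0 i *: Psi false (phi (delta_mx i 0)))); last first.
    by move=> i _; rewrite rowK.
  rewrite -(lin_sum (Psi_lin false) (L0 false)) //.
  apply: (lin_ext (Psi_lin false) (L0 false)) => //; case.
    exact: P1T0.
  apply/matrixP => i j; rewrite summxE (bigD1 i) //= big1 ?addr0.
    by rewrite !mxE !eqxx mulr1.
  by move=> l li; rewrite !mxE eq_sym (negPf li) mulr0.
have phiK (f : mxfam P1 AF) j : phi (col x0 (f false)) j = f j.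
  case: j; first exact: P1T0.
  by apply/matrixP => i j; rewrite !mxE (x0P j).
exists Theta; split.
- apply/inj_row_free => u; rewrite ThetaP => /(Psi_ker false _ (homAF _)).
  (* A e_F vanishes at T, so g kills the image of (P0_T)^d, which is all of P0_F. *)
  case=> g [hg gP]; have gF : g false = 0.
    apply: (row_full_inj P0full); rewrite mulmx0 mxcol_mul.
    apply/mxcolP => a; rewrite mxcolK submxcol0.
    have /= -> := hg a; rewrite (eq_left_ideal_false (g true) 0).
    by rewrite mul0mx.
  have /matrixP H := gP false; apply/rowP => i.
  by have := H i x0; rewrite gF mulmx0 !mxE.
- rewrite -sub1mx; apply/row_subP => i.
  have [f [hf <-]] := Psi_surj false (row i 1%:M).
  rewrite -(lin_ext (Psi_lin false) (L0 false) _ _ (phiK f)) //.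
  by rewrite -[col _ _]trmxK -ThetaP submxMl.
move=> u u0.
pose f a := phi (u a)^T.
pose rm (a : 'I_d) : mxfam AF AT := rmul k (Q := O) a.
have /(Psi_ker true _ (homAT _)) [g [hg gP]] :
    Psi true (fun j => \sum_a 1 *: (f a j *m rm a j)) = 0.
  rewrite (lin_sum (Psi_lin true) (L0 true)) // -[RHS]u0.
  apply: eq_bigr => a _; rewrite scale1r ThetaP.
  exact: (Psi_arr a).
(* g is determined by its component at T; comparing coefficients at the path [qarrow b] isolates R
   b. *)
exists (col y0 (g true)) => b; apply/colP => i.
have /matrixP/(_ i (enum_rank (qarrow b))) := gP false.
rewrite p1R mulmx_suml !summxE (bigD1 b) //= big1 ?addr0; last first.
  move=> a /negPf ab; rewrite scale1r mxE big1 // => x _.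
  by rewrite rmul_arrow ab mulr0.
rewrite (bigD1 b) //= big1 ?addr0; last first.
  move=> a /negPf ab; rewrite -mulmxA; have /= -> := hg a.
  rewrite mulmxA mxE big1 // => x _.
  by rewrite left_ideal_arrow ab mulr0.
rewrite scale1r -mulmxA; have /= -> := hg b.
rewrite mulmxA [LHS]mxE [RHS]mxE.
rewrite (bigD1 x0) //= big1 ?addr0; last by move=> x; rewrite (x0P x) eqxx.
rewrite (bigD1 y0) //= big1 ?addr0; last by move=> x; rewrite (y0P x) eqxx.
rewrite rmul_arrow left_ideal_arrow eqxx !mulr1 !mxE => ->.
by apply: eq_bigr => l _; rewrite !mxE.
Qed.
End Transpose.

Section TauInverse.
Variables (k : fieldType) (d : nat).
Local Notation O := (opq (kronecker d)).

(** No arrow ends at T, so a complement of the kernel there, together with all of X_F, is a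
    submodule. *)
Lemma superfluous_source_free (X Y : rep k O) (f : mxfam X Y) :
  superfluous_kernel f -> row_free (f true).
Proof.
pose U (b : vertex O) : 'M[k]_(rdim X b) :=
  match b as b0 return 'M[k]_(rdim X b0) with
  | true => ((kermx (f true))^C)%MS | false => 1%:M end.
have sU : is_submodule U by move=> a; rewrite /= submx1.
move=> sf; have : row_full (U true).
  apply: sf sU _ true => -[]; last by rewrite -sub1mx addsmxSl.
  by rewrite /= addsmxC addsmx_compl_full.
move=> /eqP /= Ufull; rewrite -kermx_eq0 -mxrank_eq0.
have := mxrank_compl (kermx (f true)); have := rank_leq_row (kermx (f true)).
by rewrite Ufull; lia.
Qed.

(* The submodule (X_T, sum_a X_T a) and the kernel have the sum X. *)
Lemma superfluous_stack_full (X Y : rep k O) (f : mxfam X Y) :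
  is_epi f -> superfluous_kernel f -> row_full (stack (opmap Y)) ->
  row_full (stack (opmap X)).
Proof.
move=> [hf epi_f] sf Yfull.
pose U (b : vertex O) : 'M[k]_(rdim X b) :=
  match b as b0 return 'M[k]_(rdim X b0) with
  | true => 1%:M | false => <<stack (opmap X)>>%MS end.
have sU : is_submodule U.
  move=> a; rewrite /= mul1mx genmxE.
  exact: (iffRL (stack_sub (opmap X) (stack (opmap X))) (submx_refl _) a).
have : row_full (U false).
  apply: (sf U sU) => -[]; first by rewrite -sub1mx addsmxSl.
  have /submxP[D eD] : (f false <= U false *m f false)%MS.
    apply: submx_trans (submx1 _) _.
    move: Yfull; rewrite -sub1mx => /submx_trans; apply; apply/stack_sub => a.
    rewrite -(eqmxMfull (opmap Y a) (epi_f true)).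
    have /= <- := hf a; by apply: submxMr; have := sU a; rewrite /= mul1mx.
  rewrite -sub1mx -(subrK (D *m U false) 1%:M) addrC; apply: addmx_sub_adds.
    exact: submxMl.
  by apply/sub_kermxP; rewrite mulmxBl mul1mx -mulmxA -eD subrr.
by rewrite /row_full mxrank_gen.
Qed.

(* Dualizing P1_F -> (P0_T)^d -> (DM)_F yields an exact sequence M_1 -> M_2^d -> N_1, *)
(* whence sigma^2 N embeds in M at the vertex 1.                                      *)
Lemma tau_inv_nilpotent (M N : rep k (kronecker d)) :
  (3 <= d)%N -> is_tau_inv M N -> sigma_nilpotent M -> sigma_nilpotent N.
Proof.
move=> d3 [P1 [P0 [p1 [p0 [[[_ proj0] [hom1 epi0] ker10 s0 s1] coker]]]]] [J MJ].
exists J.+2; apply/eqP; rewrite -leqn0 -MJ.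
have Mfree : row_free (\mxrow_a kmap M a).
  apply/inj_row_free => v; rewrite mul_mxrow => v0.
  apply: (kdim_eq0_free d3 MJ) => a.
  by rewrite -[LHS](mxrowK (fun a => v *m kmap M a)) v0 submxrow0.
have DMfull : row_full (stack (opmap (dualr M))).
  rewrite /row_full -mxrank_tr tr_mxcol; apply/eqP; rewrite -[RHS](eqP Mfree).
  by congr (\rank _); apply: eq_mxrow => a; rewrite trmxK.
have P0full := superfluous_stack_full epi0 s0 DMfull.
have P0free := projective_stack_free (s := true) proj0.
have p0free := superfluous_source_free s0.
have p0full : row_full (p0 true) by case: epi0.
have p1T0 : p1 true = 0.
  apply/eqP; rewrite -submx0; apply: submx_trans (_ : _ <= kermx (p0 true))%MS _.
    by rewrite (eqmxP (ker10 true)).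
  by move: p0free; rewrite -kermx_eq0 => /eqP->; rewrite sub0mx.
have P1T : rdim P1 true = 0%N.
  by have := superfluous_source_free s1; rewrite p1T0 /row_free mxrank0 => /eqP.
have /submxP[R0 R0P] := submx_full (p1 false) P0full.
pose R a : 'M[k]_(rdim P1 false, rdim P0 true) := submxrow R0 a.
have p1R : p1 false = \sum_a R a *m opmap P0 a.
  by rewrite R0P -mul_mxrow_mxcol submxrowK.
pose S a := R a *m p0 true.
have [Theta [Tfree Tfull ThetaP]] := coker_coords P1T P0full p1R coker.
apply: (@kdim_shift2 _ _ _ _ _ (kmap M) _ _ _ (fun a => (S a)^T *m Theta)).
- move=> n W W0.
  have ex i : exists g : 'cV_(rdim P0 true),
      forall a, (row i (W a) *m pinvmx Theta)^T = R a *m g.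
    apply: (ThetaP (fun a => row i (W a) *m pinvmx Theta)).
    transitivity (row i (\sum_a W a *m kmap N a)); last by rewrite W0 row0.
    rewrite [RHS]linear_sum; apply: eq_bigr => a _.
    by rewrite mulmxKpV ?submx_full //= row_mul.
  have [g gP] := fin_all_exists ex.
  exists (\matrix_i ((g i)^T *m (pinvmx (p0 true))^T)) => a; apply/row_matrixP => i.
  have -> : (S a)^T = (p0 true)^T *m (R a)^T by exact: trmx_mul.
  rewrite row_mul rowK -(mulmxA (g i)^T) !mulmxA -(mulmxA (g i)^T).
  rewrite -trmx_mul mulmxVp // trmx1 mulmx1 -trmx_mul -gP trmxK.
  by rewrite mulmxKpV ?submx_full.
move=> n W W0.
have WS : \sum_a W a *m (S a)^T = 0.
  apply: (row_free_inj Tfree); rewrite mul0mx mulmx_suml -[RHS]W0.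
  by apply: eq_bigr => a _; rewrite mulmxA.
(* A column of K is a relation on DM. It lifts to P0 with values in the kernel of p0, hence comes
   from P1; freeness of P0 then makes H a multiple of R. *)
pose K := cokermx (\mxrow_a kmap M a).
have K0 : \sum_a kmap M a *m submxcol K a = 0.
  by rewrite -mul_mxrow_mxcol submxcolK mulmx_coker.
pose H a := (submxcol K a)^T *m pinvmx (p0 true).
have HK a : H a *m p0 true = (submxcol K a)^T by rewrite mulmxKpV ?submx_full.
have /submxP[D DP] : ((\sum_a H a *m opmap P0 a)%R <= p1 false)%MS.
  rewrite (eqmxP (ker10 false)); apply/sub_kermxP.
  transitivity (\sum_a kmap M a *m submxcol K a)^T; last by rewrite K0 trmx0.
  rewrite mulmx_suml [RHS]linear_sum; apply: eq_bigr => a _.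
  have [/(_ a) /= hom0 _] := epi0; rewrite -mulmxA hom0 mulmxA HK.
  by rewrite /= trmx_mul.
have HR a : H a = D *m R a.
  rewrite -[H a](mxrowK H) -[D *m R a](mxrowK (fun a => D *m R a)); congr submxrow.
  apply: (row_free_inj P0free); rewrite !mul_mxrow_mxcol DP p1R mulmx_sumr.
  by apply: eq_bigr => b _; rewrite mulmxA.
have /submxP[V VP] : (\mxrow_a W a <= \mxrow_a kmap M a)%MS.
  rewrite submxE -/K -[K]submxcolK mul_mxrow_mxcol.
  rewrite (eq_bigr (fun a => W a *m (S a)^T *m D^T)).
    by rewrite -mulmx_suml WS mul0mx.
  by move=> a _; rewrite -[submxcol K a]trmxK -HK HR -mulmxA -/(S a) trmx_mul mulmxA.
by exists V => a; rewrite -[W a](mxrowK W) VP -mul_submxrow mxrowK.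
Qed.
End TauInverse.

(** * From projectives to all preprojectives *)

Section Preprojective.
Variables (k : fieldType) (d : nat).
Hypothesis d_ge3 : (3 <= d)%N.
Implicit Types M X Y : rep k (kronecker d).

Lemma sigma_nilpotent_iso M X : isor M X -> sigma_nilpotent X -> sigma_nilpotent M.
Proof.
case=> f [hf ff] [J XJ]; exists J; apply/eqP; rewrite -leqn0 -XJ.
apply: (@kdim_leq _ _ _ _ _ _ _ _ _ (f false) (f true)) => [a|].
  exact: hf.
by case/andP: (ff false).
Qed.

Lemma kdim_eq0_mono I J x y (A : 'I_d -> 'M[k]_(x, y)) :
  (I <= J)%N -> kdim I A = 0%N -> kdim J A = 0%N.
Proof.
move=> /subnKC <-; elim: (J - I)%N => [|n IH] A0; first by rewrite addn0.
by rewrite addnS kdim_eq0S // IH.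
Qed.

Lemma sigma_nilpotent_dsum M X Y : isor M (dsum X Y) ->
  sigma_nilpotent X -> sigma_nilpotent Y -> sigma_nilpotent M.
Proof.
move=> /isor_dsumP[p [q [hp hq fpq _]]] [I XI] [J YJ].
exists (maxn I J); apply/eqP; rewrite -leqn0.
have := @kdim_joint _ _ (maxn I J) _ _ (kmap M) _ _ (kmap X) (p false)
  (p true) _ _ (kmap Y) (q false) (q true) hp hq (fpq false).
by rewrite (kdim_eq0_mono _ XI) ?leq_maxl // (kdim_eq0_mono _ YJ) ?leq_maxr.
Qed.

Lemma tau_inv_iter_nilpotent r P X : sigma_nilpotent P -> is_tau_inv_iter r P X ->
  sigma_nilpotent X.
Proof.
move=> Pn; elim: r X => [|r IH] X /=.
  by move/isor_sym/sigma_nilpotent_iso; apply.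
by case=> Y [/IH Yn YX]; apply: tau_inv_nilpotent YX Yn.
Qed.

Lemma preprojective_summand M X Y : isor M (dsum X Y) -> preprojective M ->
  preprojective X.
Proof.
move=> /isor_dsumP[p [q [hp hq fpq dM]]] prepM X1 X2.
move=> /isor_dsumP[r [s [hr hs frs dX]]] indX1.
apply: (prepM X1 (dsum X2 Y)) => //; apply/isor_dsumP.
exists (fun i => p i *m r i), (fun i => row_mx (p i *m s i) (q i)); split.
- by move=> a; rewrite mulmxA hp -!mulmxA hr.
- move=> a; rewrite /= mul_mx_row mul_row_block !mulmx0 addr0 add0r hq.
  by rewrite mulmxA hp -!mulmxA hs.
- move=> i; apply/inj_row_free => v; rewrite !mul_mx_row => /eqP.
  rewrite !row_mx_eq0 => /and3P[/eqP vpr /eqP vps /eqP vq].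
  apply: (row_free_inj (fpq i)); rewrite /= mul0mx mul_mx_row vq.
  suff -> : v *m p i = 0 by rewrite row_mx0.
  apply: (row_free_inj (frs i)); rewrite /= mul0mx mul_mx_row -!mulmxA vpr vps.
  by rewrite row_mx0.
- by move=> i; rewrite dM dX /= addnA.
Qed.

Lemma isor_dsumC M X Y : isor M (dsum X Y) -> isor M (dsum Y X).
Proof.
move=> /isor_dsumP[p [q [hp hq fpq dM]]]; apply/isor_dsumP; exists q, p; split=> //.
  move=> i; apply/inj_row_free => v; rewrite mul_mx_row => /eqP.
  rewrite row_mx_eq0 => /andP[/eqP vq /eqP vp]; apply: (row_free_inj (fpq i)).
  by rewrite /= mul0mx mul_mx_row vp vq row_mx0.
by move=> i; rewrite dM addnC.
Qed.

Lemma isor_dsum0 M : isor M (dsum M (rep0 k _)).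
Proof.
apply/isor_dsumP; exists (fun i => 1%:M), (fun i => 0); split=> [a|a|i|i].
- by rewrite mulmx1 mul1mx.
- by rewrite !mulmx0.
- apply/inj_row_free => v; rewrite mul_mx_row mulmx1 => /eqP.
  by rewrite row_mx_eq0 => /andP[/eqP].
- by rewrite addn0.
Qed.

Lemma dimr_dsum M X Y : isor M (dsum X Y) -> dimr M = (dimr X + dimr Y)%N.
Proof.
move=> /isor_dsumP[p [q [_ _ _ dM]]]; rewrite /dimr -big_split /=.
by apply: eq_bigr => i _; rewrite dM.
Qed.

(** Induction on the dimension: summands of a preprojective are preprojective, and an indecomposable
    one is some tau^-r P. *)
Lemma preprojective_sigma_nilpotent M : preprojective M -> sigma_nilpotent M.
Proof.
have [n] := ubnP (dimr M); elim: n M => // n IH M Mn prepM.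
have [M0|M0] := posnP (dimr M).
  by exists 0%N; move: M0; rewrite /dimr big_bool /=; lia.
have [indM|] := classic (indecomposable M).
  have [r [P [projP _ PM]]] := prepM _ _ (isor_dsum0 M) indM.
  exact: tau_inv_iter_nilpotent (projective_sigma_nilpotent projP) PM.
(* If M were not sigma-nilpotent, induction would exclude every decomposition into two nonzero
   summands, making M indecomposable. *)
move=> nind; apply: NNPP => Mnil; apply: nind; split=> // X Y MXY.
apply: NNPP => /not_or_and[/eqP X0 /eqP Y0]; apply: Mnil.
have := dimr_dsum MXY => dM.
apply: (sigma_nilpotent_dsum MXY).
  by apply: IH (preprojective_summand MXY prepM); lia.
by apply: IH (preprojective_summand (isor_dsumC MXY) prepM); lia.
Qed.
End Preprojective.

Theorem proposition9 (R : realType) (k : fieldType) (d : nat) (hd : (3 <= d)%N) :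
  hyperfinite R (@preprojective k (kronecker d)).
Proof.
move=> e e0; have [L [L0 LP]] := sigma_nilpotent_hyperfinite k hd e0.
by exists L; split=> // M /(preprojective_sigma_nilpotent hd)/LP.
Qed.
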